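(* Let $L\in\mathbb{N}$, let $p_i\in[0,1)$ and $q_{ij}\in[0,1]$ for $i,j\in\{1,\dots,L\}$, with $\prod_{\ell=1}^L(1-q_{\ell j})<1$ for each $j\in\{1,\dots,L\}$. Let $X^1(\cdot)$ be the roundabout Markov chain with these parameters, and let $b_{ij}$ be the expected number of time steps that a vehicle of type $j$ occupies cell $i$ during its time on the roundabout. A necessary and sufficient condition for the roundabout model to be stable (meaning that the Markov chain $X^1(\cdot)$ is positive recurrent) is that $$p_i<\pi_{i0}:=1-\sum_{j=1}^L b_{ij}\,p_j\qquad\text{for all } i\in\{1,2,\dots,L\}.$$
   Context: **Roundabout model.** There are $L$ cells arranged in a ring and one queue in front of each cell; cells and queues are indexed by $i\in\{1,\dots,L\}$ cyclically (index $i+1$ is read as $1$ when $i=L$). Each cell is either empty (state $0$) or occupied by one vehicle of some type $j\in\{1,\dots,L\}$ (state $j$), where $j$ is the cell at which the vehicle entered the roundabout. Each queue has a length in $\mathbb{Z}_+=\{0,1,2,\dots\}$. The process $X^1(\cdot)=\{X^1(t):t\in\mathbb{Z}_+\}$ is the discrete-time Markov chain on $(\mathbb{Z}_+\times\{0,\dots,L\})^L$ recording all queue lengths and cell states. From time $t$ to $t+1$, for every $i$: 1. If cell $i$ and queue $i$ are both empty at time $t$, then cell $i+1$ is empty at time $t+1$; queue $i$ has length $1$ at time $t+1$ if a new vehicle arrives to queue $i$, and $0$ otherwise. 2. If cell $i$ is empty and queue $i$ is nonempty, then the vehicle at the front of queue $i$ leaves the queue and cell $i+1$ is in state $i$ at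 time $t+1$; queue $i$ keeps its length if a new vehicle arrives to it, and decreases by one otherwise. 3. If cell $i$ is in state $j\ge1$, then queue $i$ grows by one if a new vehicle arrives and otherwise stays the same; with probability $q_{ij}$ the vehicle in cell $i$ leaves the system and cell $i+1$ is empty at time $t+1$, and otherwise cell $i+1$ is in state $j$ at time $t+1$. At each time step a new vehicle arrives to queue $i$ with probability $p_i$. All arrival and departure decisions are independent of each other and of the current state and history of the process. **Positive recurrence.** $X^1(\cdot)$ is irreducible and aperiodic on the set of states that can be reached from the empty state (all cells and queues empty); positive recurrence is understood for the chain on this set. **The numbers $b_{ij}$.** Put $q_{\ell j}:=q_{ij}$ for $\ell>L$ whenever $\ell\equiv i\pmod L$, $i\in\{1,\dots,L\}$. The time spent on the roundabout by a type-$j$ vehicle is distributed as $T_j$, where $\mathbb{P}(T_j=0)=0$ and $\mathbb{P}(T_j=k)=\prod_{\ell=j+1}^{j+k-1}(1-q_{\ell j})\,q_{j+k,j}$ for $k\ge1$ (empty product $=1$). Such a vehicle successively occupies the cells $j+1,j+2,\dots,j+T_j$ (indices modulo $L$); $N_{ij}$ is the number of $k\in\{1,\dots,T_j\}$ with $j+k\equiv i\pmod L$, and $b_{ij}:=\mathbb{E}N_{ij}$. *)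

(* Defs.v *)
From HB Require Import structures.
From mathcomp Require Import all_boot all_order all_algebra.
From mathcomp Require Import all_classical all_reals all_analysis.

Set Implicit Arguments.
Unset Strict Implicit.
Unset Printing Implicit Defensive.

Import Order.TTheory GRing.Theory Num.Theory.

Local Open Scope classical_set_scope.
Local Open Scope ring_scope.

Section markov_chain.
Context {R : realType} {S : choiceType}.
Variable P : S -> S -> R.

(* P_x (X_1 = s_1, ..., X_n = s_n) for s = [:: s_1; ...; s_n] *)
Fixpoint path_prob (x : S) (s : seq S) : R :=
  if s is y :: s' then P x y * path_prob y s' else 1.

Definition reachable (x y : S) : Prop :=
  exists2 s : seq S, 0 < path_prob x s & last x s = y.

(* P_x (tau_x = n), where tau_x = inf {t >= 1 | X_t = x} *)
Definition return_law (x : S) (n : nat) : \bar R :=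
  if n is m.+1 then
    (\esum_(s in [set s : seq S | size s = m /\ x \notin s])
       (path_prob x (rcons s x))%:E)%E
  else 0%E.

(* tau_x is almost surely finite and has a finite mean under P_x *)
Definition positive_recurrent_state (x : S) : Prop :=
  (\sum_(0 <= n <oo) return_law x n = 1)%E /\
  (\sum_(0 <= n <oo) n%:R%:E * return_law x n < +oo)%E.

Definition positive_recurrent_on (C : set S) : Prop :=
  forall x, C x -> positive_recurrent_state x.

End markov_chain.

(* Cells and queues are numbered by 'I_L, i.e. from 0 instead of 1; cell i + 1
   is ordS i and cell i - 1 is ord_pred i, both cyclic. *)
Section roundabout.
Context {R : realType} {L : nat}.

(* (x i).1 is the length of queue i; (x i).2 is None if cell i is empty and
   Some j if it is occupied by a vehicle of type j. *)
Definition state := {ffun 'I_L -> nat * option 'I_L}.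

Definition empty_state : state := [ffun=> (0%N, None)].

(* The decisions of one time step: w.1 i says whether a vehicle arrives to
   queue i, and w.2 (i, j) whether a type-j vehicle in cell i would leave.
   Drawing a decision for every pair (i, j) makes their law independent of the
   state; only those with cell i in state j are used. *)
Definition decisions :=
  ({ffun 'I_L -> bool} * {ffun 'I_L * 'I_L -> bool})%type.

Definition next_queue (x : state) (w : decisions) (i : 'I_L) : nat :=
  match x i with
  | (0, None) => w.1 i
  | (n.+1, None) => n + w.1 i
  | (n, Some _) => n + w.1 i
  end%N.

(* the content of cell i + 1 one step after x *)
Definition pushed (x : state) (w : decisions) (i : 'I_L) : option 'I_L :=
  match x i with
  | (0, None) => None
  | (_.+1, None) => Some i
  | (_, Some j) => if w.2 (i, j) then None else Some j
  end%N.

Definition next_state (x : state) (w : decisions) : state :=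
  [ffun i => (next_queue x w i, pushed x w (ord_pred i))].

Variables (p : 'I_L -> R) (q : 'I_L -> 'I_L -> R).

Definition decisions_prob (w : decisions) : R :=
  (\prod_(i < L) bernoulli_pmf (p i) (w.1 i)) *
  (\prod_(ij : 'I_L * 'I_L) bernoulli_pmf (q ij.1 ij.2) (w.2 ij)).

Definition roundabout_trans (x y : state) : R :=
  \sum_(w : decisions | next_state x w == y) decisions_prob w.

Definition roundabout_stable : Prop :=
  positive_recurrent_on roundabout_trans
    [set x | reachable roundabout_trans empty_state x].

Definition cell_from (j : 'I_L) (k : nat) : 'I_L := iter k (@ordS L) j.

(* P (T_j = k) *)
Definition dwell_law (j : 'I_L) (k : nat) : R :=
  if k is 0%N then 0 else
  (\prod_(1 <= l < k) (1 - q (cell_from j l) j)) * q (cell_from j k) j.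

(* the value of N_ij on the event T_j = n *)
Definition visits (i j : 'I_L) (n : nat) : nat :=
  count (fun k => cell_from j k == i) (iota 1 n).

(* b_ij = E N_ij, as an extended real (a series of nonnegative terms) *)
Definition mean_visits (i j : 'I_L) : \bar R :=
  (\sum_(0 <= n <oo) (dwell_law j n * (visits i j n)%:R)%:E)%E.

Definition pi0 (i : 'I_L) : \bar R :=
  (1 - \sum_(j < L) mean_visits i j * (p j)%:E)%E.

End roundabout.

(* Main.v *)
From HB Require Import structures.
Require Import Defs.
From mathcomp Require Import all_boot all_order all_algebra.
From mathcomp Require Import all_classical all_reals all_analysis.
From mathcomp Require Import ring lra zify.

(* Let W_i be the expected number of slots at cell i still to be claimed by all
   vehicles now in the system.  Its drift is exactly sum_j (1_(i=j) + b_ij) p_j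
   minus the indicator that cell i or queue i is nonempty.
   Necessity: if that sum is at least 1 for some i, then W_i is a submartingale
   started from 0 at the empty state and at least 1 on average after one step;
   having bounded increments, it cannot vanish again at a return time of finite
   mean.
   Sufficiency: W_i has negative drift whenever queue i is nonempty.  When queue
   i is empty, cell i is visited only by vehicles coming from cell i - 1, so W_i
   is at most W_(i-1) up to a constant.  After a small tilt making this
   inequality strict by a multiple of the total queue length, the coordinates
   with an empty queue are negligible in sum_i exp (theta W_i), which is then a
   Foster-Lyapunov function. *)

Set Implicit Arguments.
Unset Strict Implicit.
Unset Printing Implicit Defensive.

Import Order.TTheory GRing.Theory Num.Theory.
Import numFieldNormedType.Exports.
Local Open Scope classical_set_scope.
Local Open Scope ring_scope.

(** * Chains driven by a finite random map *)

Lemma ge0_esumZl {R : realType} {T : choiceType} (A : set T) (c : R)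
    (f : T -> \bar R) : 0 <= c -> (forall i, 0 <= f i)%E ->
  (\esum_(i in A) (c%:E * f i) = c%:E * \esum_(i in A) f i)%E.
Proof.
move=> c0 f0; rewrite /esum -ereal_supZl //; last first.
  apply/set0P; exists (\sum_(x \in set0) f x)%E; exists set0 => //.
  exact: fsets_set0.
congr ereal_sup; apply/seteqP; split => [_ [B [Bf BA] <-]|_ [_ [B [Bf BA] <-] <-]].
  exists (\sum_(x \in B) f x)%E; first by exists B.
  by rewrite ge0_mule_fsumr.
by exists B => //; rewrite ge0_mule_fsumr.
Qed.

Section random_map_chain.
Context {R : realType} {S : choiceType} {D : finType}.
Variables (step : S -> D -> S) (mu : D -> R).
Hypothesis mu_ge0 : forall w, 0 <= mu w.
Hypothesis mu1 : \sum_w mu w = 1.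

(** An abstract form of [roundabout_trans]: for [next_state] and [decisions_prob] the two are
    convertible. *)
Definition step_trans (x y : S) : R := \sum_(w | step x w == y) mu w.

Definition mean_next (g : S -> R) (y : S) : R := \sum_w mu w * g (step y w).

(** The transition operator of the chain killed on entering [x]. The test bears on the new state, so
    iterates started at [x] measure the return time. *)
Definition killed (x : S) (g : S -> R) (y : S) : R :=
  \sum_(w | step y w != x) mu w * g (step y w).

(* P_y (tau_x > n) *)
Definition avoid (x : S) (n : nat) : S -> R := iter n (killed x) (fun=> 1).

Lemma killed_le x g h : (forall y, g y <= h y) ->
  forall y, killed x g y <= killed x h y.
Proof. by move=> gh y; apply: ler_sum => w _; rewrite ler_wpM2l. Qed.

Lemma iter_killed_le x n g h : (forall y, g y <= h y) ->
  forall y, iter n (killed x) g y <= iter n (killed x) h y.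
Proof. by move=> gh; elim: n => [|n IH] //= y; apply: killed_le. Qed.

Lemma killed_ge0 x g : (forall y, 0 <= g y) -> forall y, 0 <= killed x g y.
Proof. by move=> g0 y; apply: sumr_ge0 => w _; rewrite mulr_ge0. Qed.

Lemma killed_le_mean_next x g y : (forall y, 0 <= g y) ->
  killed x g y <= mean_next g y.
Proof.
move=> g0; rewrite /mean_next (bigID (fun w => step y w != x)) /=.
by rewrite lerDl sumr_ge0 // => w _; rewrite mulr_ge0.
Qed.

Lemma killedD x g h y :
  killed x (fun z => g z + h z) y = killed x g y + killed x h y.
Proof. by rewrite /killed -big_split; apply: eq_bigr => w _; rewrite mulrDr. Qed.

Lemma killedZ x c g y : killed x (fun z => c * g z) y = c * killed x g y.
Proof. by rewrite /killed mulr_sumr; apply: eq_bigr => w _; rewrite mulrCA. Qed.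

Lemma killed_sum x n (F : nat -> S -> R) y :
  killed x (fun z => \sum_(0 <= k < n) F k z) y =
  \sum_(0 <= k < n) killed x (F k) y.
Proof.
rewrite /killed exchange_big /=; apply: eq_bigr => w _.
by rewrite mulr_sumr.
Qed.

Lemma mean_next_cst c y : mean_next (fun=> c) y = c.
Proof. by rewrite /mean_next -mulr_suml mu1 mul1r. Qed.

Lemma avoid_ge0 x n y : 0 <= avoid x n y.
Proof. by elim: n y => [|n IH] y; [exact: ler01 | exact: killed_ge0]. Qed.

Lemma avoid1_le1 x y : killed x (fun=> 1) y <= 1.
Proof.
by rewrite -[leRHS](mean_next_cst 1 y) killed_le_mean_next // => ?; apply: ler01.
Qed.

Lemma avoid_decr x n y : avoid x n.+1 y <= avoid x n y.
Proof. by rewrite /avoid iterSr; apply: iter_killed_le; exact: avoid1_le1. Qed.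

Lemma avoid_nonincr x m n y : (m <= n)%N -> avoid x n y <= avoid x m y.
Proof.
elim: n => [|n IH]; first by rewrite leqn0 => /eqP ->.
rewrite leq_eqVlt => /predU1P[->//|/IH]; exact/le_trans/avoid_decr.
Qed.

Lemma avoid_le1 x n y : avoid x n y <= 1.
Proof. exact: (@avoid_nonincr x 0). Qed.

Lemma step_trans_ge0 x y : 0 <= step_trans x y.
Proof. exact: sumr_ge0. Qed.

Lemma killed_one x y : step_trans y x = 1 - killed x (fun=> 1) y.
Proof.
rewrite -[X in X - _]mu1 (bigID (fun w => step y w == x)) /= /killed.
by under [X in _ - X]eq_bigr do rewrite mulr1; rewrite addrK.
Qed.

Lemma path_prob_ge0 y s : 0 <= path_prob step_trans y s.
Proof. by elim: s y => //= z s IH y; rewrite mulr_ge0 ?step_trans_ge0. Qed.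

Lemma mulr_step_trans (F : S -> R) y z :
  step_trans y z * F z =
  \sum_w (if step y w == z then mu w * F (step y w) else 0).
Proof.
rewrite /step_trans mulr_suml big_mkcond /=; apply: eq_bigr => w _.
by case: eqP => // ->.
Qed.

(** Paths that first hit [x] at time [m + 1] carry the mass that [avoid] loses at that step; the
    induction conditions on the first decision. *)
Lemma esum_first_hit x m y :
  (\esum_(s in [set s : seq S | size s = m /\ x \notin s])
     (path_prob step_trans y (rcons s x))%:E)%E
  = (avoid x m y - avoid x m.+1 y)%:E.
Proof.
elim: m y => [|m IH] y.
  rewrite (_ : [set s | _] = [set [::]]); last first.
    by apply/seteqP; split => [s [/size0nil -> _]//|s ->].
  rewrite esum_set1 /=; last by rewrite lee_fin mulr1 step_trans_ge0.
  by rewrite mulr1 killed_one.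
have -> : avoid x m.+1 y - avoid x m.+2 y =
    \sum_(w | step y w != x)
      mu w * (avoid x m (step y w) - avoid x m.+1 (step y w)).
  rewrite /avoid [in LHS]iterS [in LHS]iterS /killed -sumrB.
  by apply: eq_bigr => w _; rewrite mulrBr.
(* Expanding the first transition over decisions lets the sums be exchanged. The default of [head]
   is harmless, since [s] has length [m + 1]. *)
transitivity (\esum_(s in [set s : seq S | size s = m.+1 /\ x \notin s])
   (\sum_w (if step y w == head x s then
     mu w * path_prob step_trans (step y w) (rcons (behead s) x) else 0)%:E))%E.
  apply: eq_esum => -[|z s] [//= _ _].
  by rewrite sumEFin -(mulr_step_trans (fun z => path_prob step_trans z _)).
rewrite esum_sum; last first.
  move=> s w _ _; case: ifP => // _.
  by rewrite lee_fin mulr_ge0 ?path_prob_ge0.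
rewrite [in RHS]big_mkcond -sumEFin; apply: eq_bigr => w _.
pose z := step y w.
transitivity (\esum_(s in [set s : seq S | size s = m.+1 /\ x \notin s] `&`
   [set s | head x s = z])
   (mu w * path_prob step_trans z (rcons (behead s) x))%:E)%E.
  rewrite [RHS]esum_mkcondr; apply: eq_esum => s _.
  rewrite -/z; case: ifPn => [/eqP e|/eqP ne].
    by rewrite ifT // inE /=.
  by rewrite ifF //; apply/negbTE; rewrite notin_setE /= => e; exact: ne.
case: ifPn => [zx|]; last first.
  rewrite negbK => /eqP zx; rewrite (_ : _ `&` _ = set0) ?esum_set0 //.
  apply/seteqP; split => // -[|u s] [[//= _]] xs /= uz.
  by move: xs; rewrite inE uz /z zx eqxx.
rewrite (@reindex_esum _ _ _ [set s | size s = m /\ x \notin s] _ (cons z)) /=.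
  rewrite EFinM -IH -ge0_esumZl // => s.
  by rewrite lee_fin path_prob_ge0.
split.
- move=> s /= [<- xs]; split => //; split => //.
  by rewrite inE negb_or xs eq_sym andbT.
- by move=> s t _ _ [].
- move=> -[|u s] [[//= [sm]]]; rewrite inE negb_or => /andP[_ xs] /= <-.
  by exists s.
Qed.
End random_map_chain.
Arguments avoid : simpl never.

(** The sums [m n] of [t k - t n] over [k < n] increase and are bounded, hence converge. For
    [N <= n] their first [N] terms give [N * (t N - t n) <= m n - m N], which is small for large
    [N], and [N * t n] is small for larger [n]. *)
Lemma nonincreasing_summable_tail {R : realType} (t : nat -> R) (B e : R) :
  (forall n, t n.+1 <= t n) -> t @ \oo --> (0 : R) ->
  (forall n, \sum_(0 <= k < n) t k - n%:R * t n <= B) -> 0 < e ->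
  exists2 n, (0 < n)%N & n%:R * t n < e.
Proof.
move=> t_decr t0 mB e0.
pose m n := \sum_(0 <= k < n) t k - n%:R * t n.
have mS n : m n.+1 - m n = n.+1%:R * (t n - t n.+1).
  rewrite /m big_nat_recr //= -natr1; ring.
have m_nd : nondecreasing_seq m.
  by apply/nondecreasing_seqP => n; rewrite -subr_ge0 mS mulr_ge0 // subr_ge0.
have m_ub : has_ubound (range m) by exists B => _ [n _ <-]; exact: mB.
have m_cvg := nondecreasing_is_cvgn m_nd m_ub.
have : \forall n \near \oo, (0 < n)%N /\ lim (m @ \oo) - m n < e / 2.
  near=> n; split; first by near: n; exact: nbhs_infty_gt.
  rewrite ltrBlDr -ltrBlDl.
  near: n; apply: (cvgr_gt (lim (m @ \oo))) => //.
  by rewrite ltrBlDr ltrDl divr_gt0.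
move=> [N _ /(_ N (leqnn N)) [N0 mN]].
have [K _ tK] : \forall n \near \oo, N%:R * t n < e / 2.
  have := @cvgr_lt _ _ _ _ _ _ t0 (e / 2 / N%:R).
  rewrite divr_gt0 ?divr_gt0 ?ltr0n // => /(_ _ isT).
  by apply: filterS => n; rewrite ltr_pdivlMr ?ltr0n // mulrC.
exists N => //; pose n := maxn N K.
have tn := tK n (leq_maxr _ _).
have h k : N%:R * (t N - t (N + k)%N) <= m (N + k)%N - m N.
  elim: k => [|k IH]; first by rewrite addn0 !subrr mulr0.
  rewrite addnS.
  have : N%:R * (t (N + k)%N - t (N + k).+1) <= m (N + k).+1 - m (N + k)%N.
    by rewrite mS ler_wpM2r ?subr_ge0 // ler_nat leqW // leq_addr.
  lra.
have := h (n - N)%N; rewrite subnKC ?leq_maxl // => {}h.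
have := nondecreasing_cvgn_le m_nd m_cvg n.
lra.
Unshelve. all: by end_near. Qed.

(** * Positive recurrence and the tail of the return time *)

Section random_map_recurrence.
Context {R : realType} {S : choiceType} {D : finType}.
Variables (step : S -> D -> S) (mu : D -> R).
Hypothesis mu_ge0 : forall w, 0 <= mu w.
Hypothesis mu1 : \sum_w mu w = 1.
Variable x : S.

Notation law := (return_law (step_trans step mu) x).
Notation t n := (avoid step mu x n x).

Let t_ge0 n : 0 <= t n. Proof. exact: avoid_ge0. Qed.
Let t_decr n : t n.+1 <= t n. Proof. exact: avoid_decr. Qed.

Lemma return_lawE n : law n.+1 = (t n - t n.+1)%:E.
Proof. exact: esum_first_hit. Qed.

Lemma return_law_ge0 n : (0 <= law n)%E.
Proof. by case: n => // n; rewrite return_lawE lee_fin subr_ge0. Qed.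

Lemma sum_return_law n : (\sum_(0 <= k < n.+1) law k = (1 - t n)%:E)%E.
Proof.
elim: n => [|n IH]; first by rewrite big_nat1 subrr.
rewrite big_nat_recr //= IH -/(law n.+1) return_lawE -EFinD.
by congr EFin; ring.
Qed.

Lemma sum_mean_return_law n :
  (\sum_(0 <= k < n.+1) k%:R%:E * law k
   = (\sum_(0 <= k < n) t k - n%:R * t n)%:E)%E.
Proof.
elim: n => [|n IH]; first by rewrite big_nat1 big_nil mul0e mul0r subrr.
rewrite big_nat_recr //= IH -/(law n.+1) return_lawE -EFinM -EFinD.
congr EFin; rewrite [in RHS]big_nat_recr //= -natr1; ring.
Qed.

(** The mean return time is the sum of its tails. Monotone tails also satisfy [n * t n <= B], so
    they vanish and return is certain. *)
Lemma positive_recurrent_of_bounded (B : R) :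
  (forall n, \sum_(0 <= k < n) t k <= B) ->
  positive_recurrent_state (step_trans step mu) x.
Proof.
move=> tB.
have tn n : n%:R * t n <= B.
  apply: le_trans (tB n).
  have -> : n%:R * t n = \sum_(0 <= k < n) t n.
    by rewrite big_const_nat subn0 iter_addr addr0 mulr_natl.
  by rewrite ler_sum_nat // => k /andP[_ kn]; apply: avoid_nonincr => //; apply: ltnW.
split.
- apply/cvg_lim => //.
  rewrite -cvg_shiftS; under eq_fun do rewrite sum_return_law.
  apply: cvg_EFin; first exact: nearW.
  rewrite -[X in _ --> X]subr0; apply: cvgB; first exact: cvg_cst.
  rewrite -cvg_shiftS.
  apply: (@squeeze_cvgr _ _ _ _ (cst 0) (fun n => B * harmonic n)).
  + apply: nearW => n; rewrite t_ge0 /= -ler_pdivrMr ?invr_gt0 // invrK mulrC.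
    exact: tn.
  + exact: cvg_cst.
  + rewrite -(mulr0 B); apply: cvgM; [exact: cvg_cst|exact: cvg_harmonic].
- apply: (@le_lt_trans _ _ B%:E); last exact: ltry.
  have ge0 k : (0 <= k%:R%:E * law k)%E by rewrite mule_ge0 ?return_law_ge0.
  apply: lime_le; first by apply: is_cvg_nneseries.
  apply: nearW => -[|n].
    by rewrite big_nil lee_fin (le_trans _ (tn 0%N)) // mul0r.
  rewrite sum_mean_return_law lee_fin lerBlDr (le_trans (tB n)) // lerDl.
  by rewrite mulr_ge0.
Qed.

Lemma positive_recurrent_tail (e : R) :
  positive_recurrent_state (step_trans step mu) x -> 0 < e ->
  exists2 n, (0 < n)%N & n%:R * t n < e.
Proof.
move=> [tot fin] e0.
have ge0 k : (0 <= k%:R%:E * law k)%E by rewrite mule_ge0 ?return_law_ge0.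
pose m := fine (\sum_(0 <= n <oo) n%:R%:E * law n)%E.
apply: (nonincreasing_summable_tail (B := m)) => //.
- have : (fun n => \sum_(0 <= k < n) law k)%E @ \oo --> (1 : \bar R)%E.
    rewrite -tot; apply: is_cvg_nneseries => n _ _; exact: return_law_ge0.
  rewrite -cvg_shiftS; under eq_fun do rewrite sum_return_law.
  move/fine_cvg => /= h.
  rewrite (_ : (fun n => t n) = (fun n => 1 - (1 - t n))); last first.
    by apply/funext => n; rewrite subKr.
  by rewrite -(subrr (1 : R)); apply: cvgB => //; exact: cvg_cst.
- move=> n; rewrite -lee_fin /m fineK; last by rewrite ge0_fin_numE // nneseries_ge0.
  by rewrite -sum_mean_return_law nneseries_lim_ge.
Qed.

(** [V] pays at least [1] per step until killing. Inductively, [killed] is applied to the bound for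
    [n] terms and the initial term [1] is added. *)
Lemma sum_avoid_le (V : S -> R) : (forall y, 0 <= V y) ->
  (forall y, killed step mu x V y <= V y - 1) ->
  forall n y, \sum_(0 <= k < n) avoid step mu x k y <= V y.
Proof.
move=> V0 Vd; elim=> [|n IH] y; first by rewrite big_nil.
rewrite big_nat_recl // -lerBrDl -[avoid _ _ _ 0 y]/(1 : R).
apply: le_trans (Vd y); apply: le_trans (killed_le step mu_ge0 x IH y).
by rewrite killed_sum.
Qed.

(* Foster's criterion: [V = f + K / d * sum_(k < N) avoid k] loses mean [1] at
   every step killed at [x], because
   [killed (sum_(k < N) avoid k) = sum_(k < N) avoid k - (1 - avoid N)]. *)
Lemma foster (f : S -> R) (F : pred S) (K d : R) (N : nat) :
  (forall y, 0 <= f y) -> 0 <= K -> 0 < d ->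
  (forall y, mean_next step mu f y <= f y - 1 + K * (F y)%:R) ->
  (forall y, F y -> avoid step mu x N y <= 1 - d) ->
  positive_recurrent_state (step_trans step mu) x.
Proof.
move=> f0 K0 d0 fd Fd.
pose G y := \sum_(0 <= k < N) avoid step mu x k y.
have G0 y : 0 <= G y by apply: sumr_ge0 => k _; exact: avoid_ge0.
have GE y : killed step mu x G y = G y - (1 - avoid step mu x N y).
  rewrite killed_sum.
  have : G y + avoid step mu x N y = 1 + \sum_(0 <= k < N) avoid step mu x k.+1 y.
    by rewrite -big_nat_recr //= big_nat_recl.
  by rewrite opprB addrA => ->; rewrite [RHS]addrC addKr.
pose V y := f y + K / d * G y.
have Kd : 0 <= K / d by rewrite divr_ge0 // ltW.
apply: (@positive_recurrent_of_bounded (V x)) => n; apply: sum_avoid_le => y.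
  by rewrite addr_ge0 // mulr_ge0.
rewrite killedD killedZ GE.
have := le_trans (killed_le_mean_next step mu_ge0 x y f0) (fd y).
(* On [F] the loss of the correction term pays for [K], because [1 - avoid N] is at least [d]
   there. *)
have : K * (F y)%:R <= K / d * (1 - avoid step mu x N y).
  case: (boolP (F y)) => [/Fd h|_]; last first.
    by rewrite mulr0 mulr_ge0 // subr_ge0 avoid_le1.
  rewrite mulr1 -mulrA ler_peMr // mulrC ler_pdivlMr // mul1r; lra.
rewrite /V; nra.
Qed.
End random_map_recurrence.

(** * Criteria for positive recurrence and for its failure *)

Section hitting.
Context {R : realType} {S : choiceType} {D : finType}.
Variables (step : S -> D -> S) (mu : D -> R).
Hypothesis mu_ge0 : forall w, 0 <= mu w.
Hypothesis mu1 : \sum_w mu w = 1.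
Variable x : S.

Notation hit n y := (1 - avoid step mu x n y).

Let hit_ge0 n y : 0 <= hit n y. Proof. by rewrite subr_ge0 avoid_le1. Qed.

(** The factor [step y w != x] counts an arrival at [x] as a hit, whereas [hit n x] would ask for a
    further return. *)
Lemma hitSE n y : hit n.+1 y =
  \sum_w mu w * (1 - (step y w != x)%:R * avoid step mu x n (step y w)).
Proof.
rewrite -[X in X - _]mu1 /avoid iterS /killed -/(avoid step mu x n).
rewrite [X in _ - X]big_mkcond /= -sumrB; apply: eq_bigr => w _.
by case: ifP => _; rewrite ?mul0r ?mul1r ?subr0 ?mulr1 // mulrBr mulr1.
Qed.

Let hit_term_ge0 n z : hit n z <= 1 - (z != x)%:R * avoid step mu x n z.
Proof. by case: eqP => _; rewrite ?mul0r ?mul1r // subr0 gerBl avoid_ge0. Qed.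

Lemma hit_step n y w : mu w * hit n (step y w) <= hit n.+1 y.
Proof.
rewrite hitSE (bigD1 w) //= ler_wpDr ?ler_wpM2l // sumr_ge0 // => v _.
by rewrite mulr_ge0 // (le_trans (hit_ge0 n (step y v))).
Qed.

Lemma hit_path y z s : last z s = x ->
  path_prob (step_trans step mu) y (z :: s) <= hit (size s).+1 y.
Proof.
elim: s y z => [|u s IH] y z lx.
  move: lx => /= ->; rewrite mulr1 /avoid /= -killed_one //.
have IHs : path_prob (step_trans step mu) z (u :: s) <=
    1 - (z != x)%:R * avoid step mu x (size s).+1 z.
  exact: le_trans (IH z u lx) (hit_term_ge0 _ _).
rewrite [leLHS]/= -/(path_prob _ z (u :: s)).
apply: le_trans (ler_wpM2l (step_trans_ge0 _ mu_ge0 _ _) IHs) _.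
rewrite mulr_suml hitSE [leRHS](bigID (fun w => step y w == z)) /=.
rewrite ler_wpDr //.
  rewrite sumr_ge0 // => w _; rewrite mulr_ge0 //.
  exact: le_trans (hit_ge0 _ _) (hit_term_ge0 _ _).
by apply: ler_sum => w /eqP ->.
Qed.

Lemma hit_iter N n w y :
  mu w ^+ N * hit n (iter N (step ^~ w) y) <= hit (N + n) y.
Proof.
elim: N y => [|N IH] y; first by rewrite mul1r.
rewrite exprS -mulrA iterSr addSn; apply: le_trans (hit_step _ _ w).
exact: ler_wpM2l.
Qed.

(** One decision that drives all of [F] to [e] in [N] steps, followed by a fixed path to [x], bounds
    the probability of hitting [x] below uniformly on [F]. *)
Lemma foster_reachable (e : S) (w : D) (N : nat) (F : pred S) (f : S -> R) (K : R) :
  0 < mu w -> step e w = e ->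
  (forall y, F y -> iter N (step ^~ w) y = e) ->
  reachable (step_trans step mu) e x ->
  (forall y, 0 <= f y) -> 0 <= K ->
  (forall y, mean_next step mu f y <= f y - 1 + K * (F y)%:R) ->
  positive_recurrent_state (step_trans step mu) x.
Proof.
move=> w0 ew Fe [s s0 sx] f0 K0 fd.
have ee0 : 0 < step_trans step mu e e.
  rewrite /step_trans (bigD1 w) ?ew //= ltr_pwDl // sumr_ge0 //.
(* The loop at [e] gives the path positive length even when [s] is empty. *)
pose d := mu w ^+ N * path_prob (step_trans step mu) e (e :: s).
have d0 : 0 < d by rewrite mulr_gt0 ?exprn_gt0 //= mulr_gt0.
apply: (foster mu_ge0 mu1 f0 K0 d0 fd (N := N + (size s).+1)) => y /Fe ye.
rewrite lerBrDr -lerBrDl; apply: le_trans (hit_iter _ _ w _).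
by rewrite ye ler_wpM2l ?exprn_ge0 // hit_path.
Qed.

(* [W] is a submartingale, so its mean at time [n] before the return to [x]
   stays at least [1]; but it is also at most [C * n * P (tau > n)]. *)
Lemma submartingale_not_positive_recurrent (W : S -> R) (C : R) :
  0 < C -> W x = 0 -> (forall y, 0 <= W y) ->
  (forall y w, W (step y w) <= W y + C) ->
  (forall y, W y <= mean_next step mu W y) -> 1 <= mean_next step mu W x ->
  ~ positive_recurrent_state (step_trans step mu) x.
Proof.
move=> C0 Wx W0 WC Wd W1 pr.
(* Killing at [x] costs nothing because [W] vanishes there. *)
have killedW y : killed step mu x W y = mean_next step mu W y.
  rewrite /mean_next [RHS](bigID (fun w => step y w != x)) /=.
  by rewrite [X in _ + X]big1 ?addr0 // => w /negPn/eqP ->; rewrite Wx mulr0.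
have lb n : 1 <= iter n.+1 (killed step mu x) W x.
  elim: n => [|n IH]; first by rewrite /= killedW.
  apply: (le_trans IH); rewrite [in leRHS]iterSr.
  by apply: iter_killed_le => // y; rewrite killedW.
have ub n y : iter n (killed step mu x) W y <= (W y + C * n%:R) * avoid step mu x n y.
  elim: n y => [|n IH] y; first by rewrite mulr0 addr0 mulr1.
  rewrite iterS /avoid iterS -/(avoid step mu x n) -killedZ.
  apply: ler_sum => w _; rewrite ler_wpM2l // (le_trans (IH _)) //.
  rewrite ler_wpM2r ?avoid_ge0 // -natr1 mulrDr mulr1 addrA addrAC lerD2r.
  exact: WC.
have Ci : 0 < C^-1 by rewrite invr_gt0.
have [[//|n] _ tn] := positive_recurrent_tail mu_ge0 mu1 pr Ci.
have := le_trans (lb n) (ub n.+1 x); rewrite Wx add0r -mulrA leNgt.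
by rewrite -ltr_pdivlMl ?mulr1 ?tn.
Qed.
End hitting.

(** * An exponential Lyapunov function *)

(** From [expR (- x) >= 1 - x] follows [expR x <= (1 - x)^-1], and [(1 + x + 2 * x ^+ 2) * (1 - x) -
    1 = x ^+ 2 * (1 - 2 * x)]. *)
Lemma expR_le_quad {R : realType} (x : R) : `|x| <= 2^-1 ->
  expR x <= 1 + x + 2 * x ^+ 2.
Proof.
rewrite ler_norml => /andP[x0 x1].
have x2 : 0 < 1 - x by lra.
have : expR x <= (1 - x)^-1.
  by rewrite -lef_pV2 ?posrE ?invr_gt0 ?expR_gt0 // invrK -expRN expR_ge1Dx.
move/le_trans; apply; rewrite -[leLHS]mul1r ler_pdivrMr //.
rewrite -subr_ge0 (_ : _ - 1 = x ^+ 2 * (1 - 2 * x)); last by ring.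
by rewrite mulr_ge0 ?sqr_ge0 //; lra.
Qed.

Section exponential_lyapunov.
Context {R : realType} {S : choiceType} {D : finType} {I : finType}.
Variables (step : S -> D -> S) (mu : D -> R).
Hypothesis mu_ge0 : forall w, 0 <= mu w.
Hypothesis mu1 : \sum_w mu w = 1.
(** For the roundabout, [V i] is the tilted workload of cell [i], [sz] the total queue length,
    [busy i] says that queue [i] is nonempty, and [prv] is the previous cell. *)
Variables (V : I -> S -> R) (sz : S -> R) (busy : I -> pred S) (prv : I -> I).
Variables (i0 : I) (B C C' e eta : R).
Hypotheses (e0 : 0 < e) (e1 : e <= 1) (C1 : 1 <= C) (eta0 : 0 < eta) (B0 : 0 <= B).
Hypothesis V_jump : forall i y w, `|V i (step y w) - V i y| <= C.
Hypothesis V_busy : forall i y, busy i y -> mean_next step mu (V i) y <= V i y - e.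
Hypothesis V_idle : forall i y, ~~ busy i y ->
  V i y <= V (prv i) y - eta * sz y + C'.
Hypothesis V_ge0 : forall i y, 0 <= V i y.
Hypothesis V_ub : forall i y, V i y <= B * (sz y + 1).

Let C0 : 0 < C. Proof. exact: lt_le_trans C1. Qed.

(** Small enough that the quadratic term [2 * (theta * C) ^+ 2] equals [theta * e / 4], a quarter of
    the drift term [theta * e]. *)
Let theta := e / (8 * C ^+ 2).
Let theta0 : 0 < theta.
Proof. by rewrite divr_gt0 ?mulr_gt0 ?exprn_gt0. Qed.

Let thetaC2 : theta * C ^+ 2 = e / 8.
Proof. by rewrite /theta; field; rewrite gt_eqF. Qed.

Let thetaC : theta * C <= 8^-1.
Proof.
have : theta * C <= theta * C ^+ 2 by rewrite ler_pM2l // expr2 ler_peMr // ltW.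
by rewrite thetaC2; move: e1; lra.
Qed.

Let g i y := expR (theta * V i y).

Let g0 i y : 0 < g i y. Proof. exact: expR_gt0. Qed.

Lemma mean_expR_le i y : mean_next step mu (g i) y <=
  g i y * (1 + theta * (mean_next step mu (V i) y - V i y) + theta * e / 4).
Proof.
have -> : mean_next step mu (g i) y =
    g i y * \sum_w mu w * expR (theta * (V i (step y w) - V i y)).
  rewrite mulr_sumr; apply: eq_bigr => w _.
  by rewrite mulrCA; congr (_ * _); rewrite /g -expRD; congr expR; ring.
rewrite ler_pM2l //.
have -> : 1 + theta * (mean_next step mu (V i) y - V i y) + theta * e / 4 =
    \sum_w mu w * (1 + theta * (V i (step y w) - V i y) + theta * e / 4).
  rewrite (eq_bigr (fun w => mu w * (1 - theta * V i y + theta * e / 4)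
                             + theta * (mu w * V i (step y w)))) => [|w _]; last by ring.
  by rewrite big_split /= -mulr_suml mu1 -mulr_sumr /mean_next; ring.
apply: ler_sum => w _; rewrite ler_wpM2l //.
have d : `|theta * (V i (step y w) - V i y)| <= theta * C.
  by rewrite normrM gtr0_norm // ler_pM2l.
apply: le_trans (expR_le_quad _) _; first by apply: le_trans d _; move: thetaC; lra.
rewrite lerD2l.
have -> : theta * e / 4 = 2 * (theta * C) ^+ 2.
  have -> : (theta * C) ^+ 2 = theta * (theta * C ^+ 2) by ring.
  by rewrite thetaC2; field.
rewrite ler_pM2l // -real_normK ?num_real // lerXn2r // nnegrE ?normr_ge0 //.
by rewrite mulr_ge0 // ltW.
Qed.

(** A growth bound that needs no drift, for idle coordinates and for states of small size. *)
Let mean_g_le2 i y : mean_next step mu (g i) y <= 2 * g i y.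
Proof.
apply: le_trans (mean_expR_le i y) _; rewrite mulrC ler_pM2r //.
have : mean_next step mu (V i) y - V i y <= C.
  rewrite -[X in _ - X](mean_next_cst step mu1 (V i y) y).
  rewrite -[leRHS](mean_next_cst step mu1 C y).
  rewrite /mean_next -sumrB; apply: ler_sum => w _.
  by rewrite -mulrBr ler_wpM2l // (le_trans (ler_norm _)).
rewrite -(ler_pM2l theta0 _ C) => h.
have : theta * e <= theta * C by rewrite ler_pM2l // (le_trans e1).
by move: thetaC theta0 C0 e0; lra.
Qed.

Let mean_g_busy i y : busy i y ->
  mean_next step mu (g i) y <= g i y - theta * e / 2 * g i y.
Proof.
move=> /V_busy b; apply: le_trans (mean_expR_le i y) _.
rewrite -[X in X - _ * _]mulr1 [X in _ - X]mulrC -mulrBr ler_pM2l //.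
have : theta * (mean_next step mu (V i) y - V i y) <= theta * (- e).
  by rewrite ler_pM2l //; lra.
have : 0 < theta * e by rewrite mulr_gt0.
lra.
Qed.

Let n := #|I|%:R : R.
Let n_gt0 : 0 < n. Proof. by rewrite ltr0n; apply/card_gt0P; exists i0. Qed.

(* The gap making idle coordinates negligible:
   [n * expR (- theta * T) <= theta * e / 4]. *)
Let T := 4 * n / (theta * theta * e).
Let tte0 : 0 < theta * theta * e. Proof. by rewrite mulr_gt0 // mulr_gt0. Qed.
Let T0 : 0 < T. Proof. by rewrite divr_gt0 // mulr_gt0. Qed.

Let te0 : 0 < theta * e / 4. Proof. by rewrite divr_gt0 // mulr_gt0. Qed.

Let T_gap : n * expR (- (theta * T)) <= theta * e / 4.
Proof.
(* With this form of [n], the claim reduces to [theta * T <= expR (theta * T)]. *)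
have tT : n = theta * e / 4 * (theta * T).
  suff aux (a b m : R) : 0 < a -> 0 < b -> m = a * b / 4 * (a * (4 * m / (a * a * b))).
    exact: aux.
  by move=> a0 b0; field; rewrite !gt_eqF.
rewrite expRN ler_pdivrMr ?expR_gt0 // {1}tT ler_pM2l //.
by apply: le_trans (expR_ge1Dx _); lra.
Qed.

(** For large [sz] an idle coordinate lies [T] below the maximum, so the maximal one is busy. Its
    loss [theta * e / 2 * g m y] is at least twice the total gain of the idle ones. *)
Lemma exponential_lyapunov : exists f : S -> R, exists K0 K : R,
  [/\ forall y, 0 <= f y, 0 <= K &
      forall y, mean_next step mu f y <= f y - 1 + K * (sz y <= K0)%R%:R].
Proof.
(* Beyond [K0], [eta * sz y - C'] exceeds [T]; [c] scales the net loss [theta * e / 4] to [1]. *)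
pose K0 := (T + C') / eta; pose c := (theta * e / 4)^-1.
have c0 : 0 < c by rewrite invr_gt0.
pose f y := c * \sum_i g i y.
have f0 y : 0 <= f y by rewrite mulr_ge0 ?sumr_ge0 ?ltW // => i _; rewrite ltW.
have fE y : mean_next step mu f y = c * \sum_i mean_next step mu (g i) y.
  rewrite /mean_next exchange_big mulr_sumr; apply: eq_bigr => w _ /=.
  by rewrite /f mulrCA -mulr_sumr.
(* Up to size [K0], [f] at most doubles in mean and is bounded by [K - 1]. *)
pose K := 1 + c * (n * expR (theta * (B * (K0 + 1)))).
have K0' : 0 <= K by rewrite addr_ge0 // mulr_ge0 ?mulr_ge0 ?expR_ge0 ?ltW.
exists f, K0, K; split => // y; rewrite fE.
case: (lerP (sz y) K0) => szy.
  rewrite mulr1.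
  have : c * \sum_i mean_next step mu (g i) y <= 2 * f y.
    rewrite mulrCA ler_pM2l // mulr_sumr; apply: ler_sum => i _; exact: mean_g_le2.
  have : f y <= K - 1.
    rewrite /K addrAC subrr add0r ler_pM2l // /n -sumr_const.
    rewrite mulr_suml ler_sum // => i _; rewrite mul1r ler_expR ler_pM2l //.
    by rewrite (le_trans (V_ub i y)) // ler_wpM2l // lerD2r.
  lra.
rewrite mulr0 addr0.
case: (@arg_maxP _ _ I i0 xpredT (fun i => V i y)) => // m _ m_max.
have gap i : ~~ busy i y -> V i y <= V m y - T.
  move=> /V_idle h; apply: le_trans h _.
  have Vm : V (prv i) y <= V m y by exact: m_max.
  move: szy; rewrite ltr_pdivrMr // [sz y * _]mulrC; move: Vm.
  by rewrite -/T; move: T => T1; lra.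
have m_busy : busy m y by case: (boolP (busy m y)) => // /gap; rewrite leNgt gtrBl T0.
(* This turns a loss proportional to [g m y] into a constant one. *)
have gm1 : 1 <= g m y.
  by rewrite -expR0 ler_expR mulr_ge0 // ltW.
have : \sum_i mean_next step mu (g i) y <=
    \sum_i (g i y - (i == m)%:R * (theta * e / 2 * g m y)
            + g m y * expR (- (theta * T))).
  apply: ler_sum => i _.
  have E0 : 0 <= g m y * expR (- (theta * T)) by rewrite mulr_ge0 ?expR_ge0 ?ltW.
  have te i' : 0 < theta * e / 2 * g i' y by rewrite mulr_gt0 // divr_gt0 // mulr_gt0.
  case: eqP => [->|_]; first by rewrite mul1r; have := mean_g_busy m_busy; lra.
  rewrite mul0r subr0.
  case: (boolP (busy i y)) => [/mean_g_busy|/gap h].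
    by have := te i; lra.
  have : g i y <= g m y * expR (- (theta * T)).
    by rewrite -expRD ler_expR -mulrN -mulrDr ler_pM2l.
  by have := mean_g_le2 i y; lra.
rewrite big_split sumrB /= -mulr_suml sumr_const -[_ *+ #|_|]mulr_natl -/n.
have -> : \sum_i (i == m)%:R = 1 :> R.
  by rewrite (bigD1 m) //= eqxx big1 ?addr0 // => i /negbTE ->.
rewrite mul1r.
have : n * (g m y * expR (- (theta * T))) <= theta * e / 4 * g m y.
  by rewrite mulrCA [leRHS]mulrC ler_pM2l.
move=> h1 h2.
have : \sum_i mean_next step mu (g i) y <= \sum_i g i y - theta * e / 4.
  have : theta * e / 4 <= theta * e / 4 * g m y.
    by rewrite ler_peMr // divr_ge0 // mulr_ge0 // ltW.
  lra.
rewrite -(ler_pM2l c0) mulrBr; congr (_ <= _ - _).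
by rewrite mulVf // gt_eqF.
Qed.
End exponential_lyapunov.

(** * Expected visits to a cell *)

Section visits.
Context {R : realType} {L : nat}.
Variable q : 'I_L -> 'I_L -> R.
Hypothesis hq : forall i j : 'I_L, 0 <= q i j <= 1.
Hypothesis hqprod : forall j : 'I_L, \prod_(l < L) (1 - q l j) < 1.
Implicit Types i j l : 'I_L.

Let L_gt0 l : (0 < L)%N. Proof. exact: leq_ltn_trans (ltn_ord l). Qed.

Lemma val_cell_from l k : val (cell_from l k) = ((l + k) %% L)%N.
Proof.
elim: k => [|k IH]; first by rewrite addn0 modn_small.
by rewrite /cell_from iterS /= -/(cell_from l k) IH addnS -addn1 modnDml addn1.
Qed.

Lemma cell_from_full l : cell_from l L = l.
Proof. by apply: val_inj; rewrite val_cell_from modnDr modn_small. Qed.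

Lemma cell_fromS l k : cell_from (ordS l) k = cell_from l k.+1.
Proof. by rewrite /cell_from iterSr. Qed.

Lemma cell_from_ord_inj l : injective (fun k : 'I_L => cell_from l k).
Proof.
move=> k m /(congr1 val) /eqP; rewrite !val_cell_from eqn_modDl !modn_small //.
by move/eqP/val_inj.
Qed.

(** The probability that a type-j vehicle survives a whole round, whatever the starting cell. *)
Let rho j := \prod_(l < L) (1 - q l j).

Let pass j l k := \prod_(0 <= m < k) (1 - q (cell_from l m) j).

Let stay_ge0 i j : 0 <= 1 - q i j.
Proof. by rewrite subr_ge0; case/andP: (hq i j). Qed.

Let pass_full j l : pass j l L = rho j.
Proof. by rewrite /pass big_mkord /rho [RHS](reindex_inj (@cell_from_ord_inj l)). Qed.

(* The expected number of visits to cell i (the current one included) by a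
   type-j vehicle now in cell l; the denominator sums over complete rounds. *)
Definition vis i l j : R :=
  (\sum_(0 <= k < L) (cell_from l k == i)%:R * pass j l k) / (1 - rho j).

Let D_gt0 j : 0 < 1 - rho j. Proof. by rewrite subr_gt0; exact: hqprod. Qed.

(** Shifting the window of [L] cells replaces the term [l == i] of index [0] by the same term times
    [rho j]; division by [1 - rho j] leaves exactly one visit. *)
Let vis_shift i l j :
  (\sum_(0 <= k < L) (cell_from l k.+1 == i)%:R * pass j l k.+1) / (1 - rho j)
  = vis i l j - (l == i)%:R.
Proof.
pose F k : R := (cell_from l k == i)%:R * pass j l k.
have : \sum_(0 <= k < L) F k + F L = F 0%N + \sum_(0 <= k < L) F k.+1.
  by rewrite -big_nat_recr //= big_nat_recl.
rewrite /F cell_from_full pass_full [pass j l 0]/pass big_geq // mulr1.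
rewrite [cell_from l 0]/= -/(F _) => E.
rewrite (_ : \sum_(0 <= k < L) _ =
  \sum_(0 <= k < L) F k + (l == i)%:R * rho j - (l == i)%:R).
  by rewrite /vis -/F; field; rewrite gt_eqF.
by rewrite E addrC addKr.
Qed.

(** First-step analysis: the current visit is counted, then the vehicle stays with probability
    [1 - q l j]. *)
Lemma vis_step i l j :
  (1 - q l j) * vis i (ordS l) j = vis i l j - (l == i)%:R.
Proof.
rewrite -vis_shift /vis mulrA mulr_sumr; congr (_ / _).
apply: eq_bigr => k _; rewrite mulrCA cell_fromS; congr (_ * _).
rewrite /pass big_nat_recl //=; congr (_ * _).
by apply: eq_bigr => m _; rewrite cell_fromS.
Qed.

(** Last-step analysis: each later visit to cell [i] follows a visit to cell [i - 1] without
    departure. *)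
Lemma vis_ord_pred i l j :
  (1 - q (ord_pred i) j) * vis (ord_pred i) l j = vis i l j - (l == i)%:R.
Proof.
rewrite -vis_shift /vis mulrA mulr_sumr; congr (_ / _).
apply: eq_bigr => k _; rewrite /pass big_nat_recr //=.
have -> : (cell_from l k.+1 == i) = (cell_from l k == ord_pred i).
  exact: (can2_eq (@ordSK L) (@ord_predK L)).
by rewrite mulrCA; case: eqP => [<-|_]; rewrite ?mul0r // !mul1r mulrC.
Qed.

Lemma vis_ge0 i l j : 0 <= vis i l j.
Proof.
apply: divr_ge0; last exact: ltW.
by apply: sumr_ge0 => k _; rewrite mulr_ge0 // prodr_ge0.
Qed.

Definition vis_bound : R := \sum_i \sum_l \sum_j vis i l j.

Lemma vis_le_bound i l j : vis i l j <= vis_bound.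
Proof.
rewrite /vis_bound (bigD1 i) //= (bigD1 l) //= (bigD1 j) //= -!addrA lerDl.
rewrite !addr_ge0 //; do ?[exact: vis_ge0 | apply: sumr_ge0 => ? _].
Qed.

Lemma vis_bound_ge0 : 0 <= vis_bound.
Proof. by do 3 (apply: sumr_ge0 => ? _); exact: vis_ge0. Qed.

(* P (T_j > k) *)
Let survive j k := \prod_(1 <= l < k.+1) (1 - q (cell_from j l) j).

Let survive_ge0 j k : 0 <= survive j k. Proof. exact: prodr_ge0. Qed.

Let surviveS j k : survive j k.+1 = survive j k * (1 - q (cell_from j k.+1) j).
Proof. by rewrite /survive big_nat_recr. Qed.

Let dwellS j k : dwell_law q j k.+1 = survive j k * q (cell_from j k.+1) j.
Proof. by []. Qed.

Let visitsS i j k :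
  visits i j k.+1 = (visits i j k + (cell_from j k.+1 == i))%N.
Proof. by rewrite /visits -[in LHS](addn1 k) iotaD count_cat /= addn0. Qed.

Let dwell_ge0 j k : 0 <= dwell_law q j k.
Proof.
case: k => // k; rewrite dwellS mulr_ge0 //.
by case/andP: (hq (cell_from j k.+1) j).
Qed.

(** The mean is split at time [n]: vehicles gone by then contribute their visits, survivors those
    made plus those expected from the next cell on. *)
Let partial_visits i j n :
  \sum_(0 <= k < n.+1) dwell_law q j k * (visits i j k)%:R
  + survive j n * ((visits i j n)%:R + vis i (cell_from j n.+1) j)
  = vis i (ordS j) j.
Proof.
elim: n => [|n IH].
  by rewrite big_nat1 mul0r add0r /survive big_geq // mul1r add0r.
rewrite big_nat_recr //= -IH -addrA; congr (_ + _).
rewrite -/(dwell_law q j n.+1) dwellS surviveS visitsS natrD.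
have := vis_step i (cell_from j n.+1) j.
rewrite [ordS _]/(cell_from j n.+2) => /eqP; rewrite eq_sym subr_eq => /eqP ->.
ring.
Qed.

Let survive_round j n : survive j (n * L) = rho j ^+ n.
Proof.
elim: n => [|n IH]; first by rewrite /survive big_geq.
rewrite mulSnr exprSr -IH {1}/survive (big_cat_nat _ (n := (n * L).+1)) //=; last first.
  by rewrite ltnS leq_addr.
congr (_ * _); rewrite -(pass_full j (cell_from j (n * L).+1)) /pass.
rewrite -[X in \prod_(X <= _ < _) _]add0n big_addn subSS addKn.
by apply: eq_bigr => m _; congr (1 - q _ _); rewrite /cell_from -iterD.
Qed.

Let visits_le i j n : (visits i j n <= n)%N.
Proof. by rewrite (leq_trans (count_size _ _)) // size_iota. Qed.

(** Dropping the survivors in [partial_visits] gives one inequality. For the other, after [n] full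
    rounds they contribute at most [n * rho j ^+ n] times a constant, which is small for a suitable
    [n]. *)
Lemma mean_visitsE i j : mean_visits q i j = (vis i (ordS j) j)%:E.
Proof.
have ge0 n : (0 <= (dwell_law q j n * (visits i j n)%:R)%:E)%E.
  by rewrite lee_fin mulr_ge0.
apply/eqP; rewrite eq_le; apply/andP; split.
  apply: lime_le; first exact: is_cvg_nneseries.
  apply: nearW => -[|n]; first by rewrite big_nil lee_fin vis_ge0.
  rewrite sumEFin lee_fin -(partial_visits i j n) lerDl mulr_ge0 //.
  by rewrite addr_ge0 ?vis_ge0.
apply/lee_addgt0Pr => e e0.
have rho0 : 0 <= rho j by exact: prodr_ge0.
have rho1 : rho j <= 1 by exact: ltW (hqprod j).
have LB0 : 0 < L%:R + vis_bound.
  by rewrite ltr_pwDl ?vis_bound_ge0 // ltr0n (L_gt0 j).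
have [|||| n n0 ne] := @nonincreasing_summable_tail R (fun n => rho j ^+ n)
  (1 - rho j)^-1 (e / (L%:R + vis_bound)).
- by move=> n; rewrite exprS ler_piMl ?exprn_ge0.
- apply: cvg_expr; rewrite ger0_norm //; exact: hqprod.
- move=> n; apply: (@le_trans _ _ (\sum_(0 <= k < n) rho j ^+ k)).
    by rewrite gerBl mulr_ge0 ?exprn_ge0.
  rewrite -div1r ler_pdivlMr // mulrC big_mkord -opprB mulNr -subrX1 opprB.
  by rewrite gerBl exprn_ge0.
- by rewrite divr_gt0.
rewrite -(partial_visits i j (n * L)) EFinD leeD //.
  by rewrite -sumEFin nneseries_lim_ge.
rewrite lee_fin survive_round.
apply: (@le_trans _ _ (n%:R * rho j ^+ n * (L%:R + vis_bound))).
  rewrite [n%:R * _]mulrC -mulrA ler_wpM2l ?exprn_ge0 // mulrDr lerD //.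
    by rewrite -natrM ler_nat.
  rewrite (le_trans (vis_le_bound _ _ _)) // ler_peMl ?vis_bound_ge0 //.
  by rewrite ler1n.
by rewrite -ler_pdivlMr // ltW.
Qed.
End visits.

(** * Drift of the workloads *)

Section bernoulli_product.
Context {R : realType} {I : finType}.
Variable r : I -> R.

Lemma bernoulli_prod_marginal (i0 : I) (phi : bool -> R) :
  \sum_(f : {ffun I -> bool}) (\prod_i bernoulli_pmf (r i) (f i)) * phi (f i0)
  = r i0 * phi true + (1 - r i0) * phi false.
Proof.
(* Absorbing [phi] into the factor [i0] turns the sum of products into a product of sums. *)
pose F i b := bernoulli_pmf (r i) b * (if i == i0 then phi b else 1).
transitivity (\sum_(f : {ffun I -> bool}) \prod_i F i (f i)).
  apply: eq_bigr => f _; rewrite big_split /=; congr (_ * _).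
  by rewrite -big_mkcond big_pred1_eq.
rewrite -bigA_distr_bigA (bigD1 i0) //= [X in _ * X]big1 ?mulr1 => [|i /negbTE ii0].
  by rewrite big_bool /F eqxx.
by rewrite big_bool /F ii0 !mulr1 /bernoulli_pmf /= subrKC.
Qed.

Lemma bernoulli_prod_sum :
  \sum_(f : {ffun I -> bool}) \prod_i bernoulli_pmf (r i) (f i) = 1.
Proof.
rewrite -(bigA_distr_bigA (fun i b => bernoulli_pmf (r i) b)) big1 // => i _.
by rewrite big_bool /bernoulli_pmf /= subrKC.
Qed.
End bernoulli_product.

(** * Workload drift and necessity of the traffic condition *)

Section roundabout_drift.
Context {R : realType} {L : nat}.
Variables (p : 'I_L -> R) (q : 'I_L -> 'I_L -> R).
Hypothesis hp : forall i, 0 <= p i < 1.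
Hypothesis hq : forall i j, 0 <= q i j <= 1.
Hypothesis hqprod : forall j, \prod_(l < L) (1 - q l j) < 1.
Implicit Types (i j l : 'I_L) (x : @state L) (w : @decisions L).

Notation mu := (decisions_prob p q).
Notation step := (@next_state L).
Notation mean := (mean_next step mu).
Notation B := (vis_bound q).

Lemma decisions_prob_ge0 w : 0 <= mu w.
Proof.
rewrite mulr_ge0 // prodr_ge0 // => i _; rewrite bernoulli_pmf_ge0 //.
by case/andP: (hp i) => -> /ltW.
Qed.

Lemma decisions_prob_sum : \sum_w mu w = 1.
Proof.
rewrite -(pair_bigA _ (fun (a : {ffun _ -> bool}) (b : {ffun _ -> bool}) =>
  (\prod_i bernoulli_pmf (p i) (a i)) *
  \prod_(ij : 'I_L * 'I_L) bernoulli_pmf (q ij.1 ij.2) (b ij))) /=.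
under eq_bigr do rewrite -mulr_sumr (bernoulli_prod_sum (fun ij => q ij.1 ij.2)) mulr1.
exact: bernoulli_prod_sum.
Qed.

Lemma mean_arrival l : \sum_w mu w * (w.1 l)%:R = p l.
Proof.
transitivity (\sum_(w : decisions) ((\prod_i bernoulli_pmf (p i) (w.1 i)) * (w.1 l)%:R) *
  \prod_(ij : 'I_L * 'I_L) bernoulli_pmf (q ij.1 ij.2) (w.2 ij)).
  by apply: eq_bigr => w _; rewrite mulrAC.
rewrite -(pair_bigA _ (fun (a : {ffun _ -> bool}) (b : {ffun _ -> bool}) =>
  ((\prod_i bernoulli_pmf (p i) (a i)) * (a l)%:R) *
  \prod_(ij : 'I_L * 'I_L) bernoulli_pmf (q ij.1 ij.2) (b ij))) /=.
under eq_bigr do rewrite -mulr_sumr (bernoulli_prod_sum (fun ij => q ij.1 ij.2)) mulr1.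
by rewrite (bernoulli_prod_marginal p l (fun b => b%:R)) mulr0 mulr1 addr0.
Qed.

Lemma mean_departure l j : \sum_w mu w * (w.2 (l, j))%:R = q l j.
Proof.
transitivity (\sum_(w : decisions) (\prod_i bernoulli_pmf (p i) (w.1 i)) *
  ((\prod_(ij : 'I_L * 'I_L) bernoulli_pmf (q ij.1 ij.2) (w.2 ij)) * (w.2 (l, j))%:R)).
  by apply: eq_bigr => w _; rewrite mulrA.
rewrite -(pair_bigA _ (fun (a : {ffun _ -> bool}) (b : {ffun _ -> bool}) =>
  (\prod_i bernoulli_pmf (p i) (a i)) *
  ((\prod_(ij : 'I_L * 'I_L) bernoulli_pmf (q ij.1 ij.2) (b ij)) * (b (l, j))%:R))) /=.
under eq_bigr do rewrite -mulr_sumr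
  (bernoulli_prod_marginal (fun ij => q ij.1 ij.2) (l, j) (fun b => b%:R)).
by rewrite -mulr_suml bernoulli_prod_sum /= mulr0 mulr1 addr0 mul1r.
Qed.

Lemma mean_decisions (a b c : R) l j :
  \sum_w mu w * (a + b * (w.1 l)%:R + c * (w.2 (l, j))%:R)
  = a + b * p l + c * q l j.
Proof.
rewrite (eq_bigr (fun w => mu w * a + b * (mu w * (w.1 l)%:R)
                         + c * (mu w * (w.2 (l, j))%:R))) => [|w _]; last by ring.
by rewrite !big_split /= -mulr_suml -!mulr_sumr decisions_prob_sum mean_arrival
  mean_departure mul1r.
Qed.

(* The number of slots at cell [i] claimed by a vehicle of queue [j]: its
   visits to cell [i], plus the passage of the empty cell [j] it fills. *)
Definition claim i j : R := (i == j)%:R + vis q i (ordS j) j.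

Definition riding i l (c : option 'I_L) : R := if c is Some j then vis q i l j else 0.

Definition workload i x : R :=
  \sum_l (claim i l * (x l).1%:R + riding i l (x l).2).

Definition used x l : bool := x l != (0%N, None).

Let vis0 i l j : 0 <= vis q i l j. Proof. exact: vis_ge0. Qed.
Let visB i l j : vis q i l j <= B. Proof. exact: vis_le_bound. Qed.
Let B0 : 0 <= B. Proof. exact: vis_bound_ge0. Qed.

Lemma claim_ge0 i j : 0 <= claim i j.
Proof. by rewrite addr_ge0. Qed.

Lemma claim_le i j : claim i j <= 1 + B.
Proof. by rewrite lerD // lern1 leq_b1. Qed.

Lemma riding_ge0 i l c : 0 <= riding i l c.
Proof. by case: c => [j|] /=. Qed.

Lemma riding_le i l c : riding i l c <= B.
Proof. by case: c => [j|] /=. Qed.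

Lemma workload_ge0 i x : 0 <= workload i x.
Proof.
by rewrite sumr_ge0 // => l _; rewrite addr_ge0 ?riding_ge0 ?mulr_ge0 ?claim_ge0.
Qed.

Lemma workload_empty i : workload i (@empty_state L) = 0.
Proof. by rewrite /workload big1 // => l _; rewrite ffunE /= mulr0 addr0. Qed.

(** Credits the new content of cell [l + 1] to [l], where it comes from, so that each term depends
    on one local state only. *)
Definition increment i x w l : R :=
  claim i l * (next_queue x w l)%:R + riding i (ordS l) (pushed x w l)
  - (claim i l * (x l).1%:R + riding i l (x l).2).

Lemma workload_next i x w :
  workload i (step x w) = workload i x + \sum_l increment i x w l.
Proof.
rewrite -big_split /=.
transitivity (\sum_l (claim i l * (next_queue x w l)%:R
                      + riding i (ordS l) (pushed x w l))).
  rewrite /workload !big_split /=; congr (_ + _).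
    by apply: eq_bigr => l _; rewrite ffunE.
  rewrite (reindex_inj (@ordS_inj L)); apply: eq_bigr => l _.
  by rewrite ffunE /= ordSK.
by apply: eq_bigr => l _; rewrite /increment addrC subrK.
Qed.

(** Besides arrivals, a riding vehicle loses its current visit by [vis_step], and an entering one
    trades [claim i l] for its visits from [ordS l] on, losing [i == l]. *)
Lemma mean_increment i x l :
  \sum_w mu w * increment i x w l
  = claim i l * p l - ((l == i) && used x l)%:R.
Proof.
rewrite /increment /next_queue /pushed /used; case: (x l) => [n [j|]].
  rewrite xpair_eqE andbF andbT.
  transitivity (\sum_w mu w * ((vis q i (ordS l) j - vis q i l j)
    + claim i l * (w.1 l)%:R + (- vis q i (ordS l) j) * (w.2 (l, j))%:R)).
    apply: eq_bigr => w _; congr (_ * _).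
    by case: n => [|n]; case: (w.2 (l, j)); rewrite /= natrD; ring.
  rewrite mean_decisions.
  have := vis_step hqprod i l j; move: (vis q i l j) => v; lra.
case: n => [|n].
  rewrite eqxx andbF.
  (* No departure matters here; the zero coefficient only fits the form of [mean_decisions]. *)
  transitivity (\sum_w mu w * (0 + claim i l * (w.1 l)%:R + 0 * (w.2 (l, l))%:R)).
    by apply: eq_bigr => w _; congr (_ * _); rewrite /=; ring.
  by rewrite mean_decisions mul0r add0r addr0 subr0.
rewrite xpair_eqE /= andbT eq_sym.
transitivity (\sum_w mu w *
  (- (i == l)%:R + claim i l * (w.1 l)%:R + 0 * (w.2 (l, l))%:R)).
  apply: eq_bigr => w _; congr (_ * _).
  by rewrite /= natrD -natr1 /claim; ring.
rewrite mean_decisions; ring.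
Qed.

Lemma mean_workload i x :
  mean (workload i) x = workload i x + \sum_l claim i l * p l - (used x i)%:R.
Proof.
rewrite /mean_next (eq_bigr (fun w => mu w * workload i x
    + \sum_l mu w * increment i x w l)) => [|w _]; last first.
  by rewrite workload_next mulrDr; congr (_ + _); rewrite mulr_sumr.
rewrite big_split /= -mulr_suml decisions_prob_sum mul1r exchange_big /=.
rewrite (eq_bigr _ (fun l _ => mean_increment i x l)) sumrB addrA; congr (_ - _).
by rewrite (bigD1 i) //= eqxx big1 ?addr0 // => l /negbTE ->.
Qed.

Lemma increment_le i x w l : `|increment i x w l| <= 1 + 2 * B.
Proof.
rewrite /increment /next_queue /pushed; case: (x l) => [n [j|]].
  rewrite (_ : _ - _ = claim i l * (w.1 l)%:R +
    (riding i (ordS l) (if w.2 (l, j) then None else Some j) - vis q i l j)); last first.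
    by case: n => [|n]; rewrite /= natrD; ring.
  have := riding_ge0 i (ordS l) (if w.2 (l, j) then None else Some j).
  have := riding_le i (ordS l) (if w.2 (l, j) then None else Some j).
  move: (riding _ _ _) => v vB v0.
  have := vis0 i l j; have := visB i l j; have := claim_ge0 i l.
  have := claim_le i l; move: B0 => B1.
  by rewrite ler_norml; case: (w.1 l); rewrite /= ?mulr1 ?mulr0; lra.
have b0 : 0 <= (i == l)%:R :> R by [].
have b1 : (i == l)%:R <= 1 :> R by rewrite lern1 leq_b1.
have := claim_ge0 i l; have := claim_le i l; move: B0 => B1 cB c0.
case: n => [|n].
  by rewrite ler_norml /=; case: (w.1 l); rewrite /= ?mulr1 ?mulr0; lra.
rewrite (_ : _ - _ = claim i l * (w.1 l)%:R - (i == l)%:R); last first.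
  by rewrite /= natrD -natr1 /claim; ring.
by rewrite ler_norml; case: (w.1 l); rewrite /= ?mulr1 ?mulr0; lra.
Qed.

Lemma workload_jump i x w :
  `|workload i (step x w) - workload i x| <= L%:R * (1 + 2 * B).
Proof.
rewrite workload_next addrAC subrr add0r; apply: le_trans (ler_norm_sum _ _ _) _.
rewrite mulr_natl -[X in _ *+ X](card_ord L) -sumr_const.
by apply: ler_sum => l _; exact: increment_le.
Qed.

(** The diagonal part of [claim] contributes [p i], and [mean_visitsE] identifies the rest with the
    sum in [pi0]. *)
Lemma pi0E i : (((p i)%:E < pi0 p q i)%E : Prop) <-> \sum_l claim i l * p l < 1.
Proof.
rewrite /pi0; under eq_bigr do rewrite mean_visitsE // -EFinM.
rewrite sumEFin -EFinB lte_fin ltrBrDr.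
suff -> : \sum_l claim i l * p l = p i + \sum_l vis q i (ordS l) l * p l by [].
under eq_bigr do rewrite /claim mulrDl.
rewrite big_split /= (bigD1 i) //= eqxx mul1r big1 ?addr0 // => l.
by rewrite eq_sym => /negbTE ->; rewrite mul0r.
Qed.

Lemma stable_traffic : (0 < L)%N -> roundabout_stable p q ->
  forall i, \sum_l claim i l * p l < 1.
Proof.
move=> L0 st i; rewrite ltNge; apply/negP => heavy.
have := @submartingale_not_positive_recurrent R state decisions step mu
  decisions_prob_ge0 decisions_prob_sum empty_state (workload i) (L%:R * (1 + 2 * B)).
apply.
- by rewrite mulr_gt0 ?ltr0n // ltr_pwDl // mulr_ge0.
- exact: workload_empty.
- exact: workload_ge0.
- by move=> x w; rewrite -lerBlDl (le_trans (ler_norm _)) ?workload_jump.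
- move=> x; rewrite mean_workload -addrA lerDl subr_ge0; apply: le_trans heavy.
  by rewrite lern1 leq_b1.
(* In the empty state no slot is used, so the mean is the full traffic, at least [1]. *)
- by rewrite mean_workload workload_empty add0r /used ffunE eqxx subr0.
- by apply: st; exists [::].
Qed.
End roundabout_drift.

(** * Stability *)

Section draining.
Context {R : realType} {L : nat}.
Variables (p : 'I_L -> R) (q : 'I_L -> 'I_L -> R).
Hypothesis hp : forall i, 0 <= p i < 1.
Hypothesis hq : forall i j, 0 <= q i j <= 1.
Hypothesis hqprod : forall j, \prod_(l < L) (1 - q l j) < 1.
Implicit Types (i j l : 'I_L) (x : @state L).

(** Nobody arrives, and departures occur exactly where [q] is positive, so this decision has
    positive probability. *)
Definition drain : @decisions L := ([ffun=> false], [ffun ij => 0 < q ij.1 ij.2]).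

Notation drained := (@next_state L ^~ drain).

Lemma drain_prob_gt0 : 0 < decisions_prob p q drain.
Proof.
rewrite mulr_gt0 // prodr_gt0 // => i _; rewrite ffunE /bernoulli_pmf.
  by rewrite subr_gt0; case/andP: (hp i).
case: ifP => // /negbT; rewrite -leNgt => q0; rewrite subr_gt0.
exact: le_lt_trans q0 ltr01.
Qed.

Lemma drain_empty : next_state (@empty_state L) drain = @empty_state L.
Proof.
by apply/ffunP => i; rewrite !ffunE /next_queue /pushed !ffunE.
Qed.

Let exit_exists l j : exists k, (k < L)%N && (0 < q (cell_from l k) j).
Proof.
have [/forallP q0|/forallPn[c]] := boolP [forall c, q c j <= 0].
  have := hqprod j; rewrite big1 ?ltxx // => c _.
  suff -> : q c j = 0 by rewrite subr0.
  by apply/eqP; rewrite eq_le q0; case/andP: (hq c j).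
(* The witness is the forward distance from [l] to [c]. *)
rewrite -ltNge => qc; exists ((c + (L - l)) %% L)%N.
rewrite ltn_mod (leq_ltn_trans _ (ltn_ord l)) //=.
suff -> : cell_from l ((c + (L - l)) %% L) = c by [].
apply: val_inj; rewrite val_cell_from modnDmr addnCA subnKC 1?ltnW //.
by rewrite modnDr modn_small.
Qed.

(* The time a type-j vehicle in cell l still rides if it exits as soon as it can. *)
Definition exit_time l j : nat := (ex_minn (exit_exists l j)).+1.

Definition exit_time_of l (c : option 'I_L) : nat :=
  if c is Some j then exit_time l j else 0%N.

(** The weight [L + 1] of a queued vehicle exceeds every exit time, so entering the ring also
    decreases the total. *)
Definition drain_time x : nat :=
  \sum_l ((x l).1 * L.+1 + exit_time_of l (x l).2).

Lemma exit_time_le l j : (exit_time l j <= L)%N.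
Proof. by rewrite /exit_time; case: ex_minnP => k /andP[]. Qed.

Lemma exit_time_step l j : ~~ (0 < q l j) ->
  (exit_time (ordS l) j < exit_time l j)%N.
Proof.
move=> q0; rewrite /exit_time ltnS.
case: (ex_minnP (exit_exists l j)) => -[|k] /andP[kL qk] _.
  by rewrite qk in q0.
case: ex_minnP => m _; apply; rewrite (ltnW kL) /=.
by rewrite /cell_from -iterSr.
Qed.

Lemma drain_time_step x : x != empty_state ->
  (drain_time (drained x) < drain_time x)%N.
Proof.
move=> xe.
have -> : drain_time (drained x) = (\sum_l
    (next_queue x drain l * L.+1 + exit_time_of (ordS l) (pushed x drain l)))%N.
  rewrite /drain_time !big_split /=; congr (_ + _)%N.
    by apply: eq_bigr => l _; rewrite ffunE.
  rewrite (reindex_inj (@ordS_inj L)); apply: eq_bigr => l _.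
  by rewrite ffunE /= ordSK.
have le l : (next_queue x drain l * L.+1 + exit_time_of (ordS l) (pushed x drain l)
    + used x l <= (x l).1 * L.+1 + exit_time_of l (x l).2)%N.
  rewrite /next_queue /pushed /used !ffunE; case: (x l) => [n [j|]] /=.
    rewrite (_ : (match n with 0 => _ | _ => _ end) = n); last first.
      by case: n => [|n] /=; rewrite ?addn0.
    rewrite xpair_eqE andbF /= -addnA leq_add2l.
    rewrite (_ : (match n with 0 => _ | _ => _ end) =
      if drain.2 (l, j) then None else Some j); last by case: n.
    rewrite ffunE /=.
    by case: ifP => [//|/negbT /exit_time_step] /=; rewrite addn1.
  case: n => [|n]; first by rewrite eqxx.
  rewrite xpair_eqE /= !addn0 mulSn.
  by have := exit_time_le (ordS l) l; move: (n * L.+1)%N => m; lia.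
have [c xc] : exists c, used x c.
  apply/existsP; apply: contraNT xe => /existsPn xe; apply/eqP/ffunP => l.
  by rewrite ffunE; apply/eqP; move: (xe l); rewrite negbK.
rewrite /drain_time (bigD1 c) // [ltnRHS](bigD1 c) //=.
rewrite -addSn leq_add //; first by have := le c; rewrite xc addn1.
by apply: leq_sum => l _; apply: leq_trans (le l); rewrite leq_addr.
Qed.

Lemma drain_iter n x : (drain_time x <= n)%N -> iter n drained x = empty_state.
Proof.
elim: n x => [|n IH] x xn; have [->|xe] := eqVneq x (@empty_state L).
- by [].
- by have := drain_time_step xe; rewrite ltnNge (leq_trans xn).
- by rewrite iterSr drain_empty IH // /drain_time big1 // => l _; rewrite ffunE.
- by rewrite iterSr IH // -ltnS (leq_trans (drain_time_step xe)).
Qed.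

Lemma drain_time_le x :
  (drain_time x <= (\sum_l (x l).1) * L.+1 + L * L)%N.
Proof.
rewrite /drain_time big_split -big_distrl /= leq_add2l.
rewrite -[X in (_ <= X * _)%N](card_ord L) -sum_nat_const leq_sum // => l _.
by case: (x l) => n [j|] //=; exact: exit_time_le.
Qed.
End draining.

(** * Sufficiency of the traffic condition *)

Section sufficiency.
Context {R : realType} {L : nat}.
Variables (p : 'I_L -> R) (q : 'I_L -> 'I_L -> R).
Hypothesis hp : forall i, 0 <= p i < 1.
Hypothesis hq : forall i j, 0 <= q i j <= 1.
Hypothesis hqprod : forall j, \prod_(l < L) (1 - q l j) < 1.
Implicit Types (i j l : 'I_L) (x : @state L) (w : @decisions L).

Notation mu := (decisions_prob p q).
Notation step := (@next_state L).
Notation mean := (mean_next step mu).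
Notation B := (vis_bound q).

Definition queued x : R := \sum_l (x l).1%:R.

Lemma queued_ge0 x : 0 <= queued x. Proof. exact: sumr_ge0. Qed.

(* A vehicle reaches cell [i] only through cell [i - 1] unless it enters at [i]. *)
Lemma claim_ord_pred i l : l != i -> claim q i l <= claim q (ord_pred i) l.
Proof.
move=> li; rewrite /claim eq_sym (negbTE li) add0r.
have /eqP := vis_ord_pred hqprod i (ordS l) l.
rewrite eq_sym subr_eq => /eqP ->; rewrite addrC lerD //.
  by rewrite eq_sym (can2_eq (@ord_predK L) (@ordSK L)) eq_sym.
rewrite ler_piMl ?vis_ge0 // gerBl.
by case/andP: (hq (ord_pred i) l).
Qed.

(* The distance from cell [i + 1] forward to cell [l]; it breaks ties between the
   workloads of neighbouring cells. *)
Definition tilt i l : nat := (l + (L - i.+1)) %% L.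

Lemma tilt_le i l : (tilt i l <= L)%N.
Proof. by rewrite ltnW // ltn_mod (leq_ltn_trans _ (ltn_ord l)). Qed.

(** Moving the origin one cell back adds one to the distance, except for [l = i], where it wraps
    from [L - 1] to [0]. *)
Lemma tilt_ord_pred i l : l != i -> (tilt i l < tilt (ord_pred i) l)%N.
Proof.
rewrite -(inj_eq val_inj) /tilt /=.
have := ltn_ord i; have := ltn_ord l.
case: i l => [i iL] [l lL] /= _ _ li.
have [i0|i0] := posnP i.
  subst i; have -> : ((0 + L).-1 %% L = L.-1)%N by rewrite add0n modn_small; lia.
  rewrite prednK ?subnn ?addn0; last lia.
  rewrite [ltnRHS]modn_small // (_ : (l + (L - 1) = l.-1 + L)%N); last lia.
  rewrite modnDr modn_small; lia.
have -> : ((i + L).-1 %% L = i.-1)%N.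
  rewrite (_ : ((i + L).-1 = i.-1 + L)%N); last lia.
  rewrite modnDr modn_small; lia.
rewrite prednK //.
case: (ltngtP l i) => il; last by rewrite il eqxx in li.
  rewrite !modn_small; lia.
rewrite (_ : (l + (L - i.+1) = (l - i.+1) + L)%N); last lia.
rewrite (_ : (l + (L - i) = (l - i) + L)%N); last lia.
rewrite !modnDr !modn_small; lia.
Qed.

Definition tilted (eta : R) i x : R :=
  workload q i x + eta * \sum_l (tilt i l)%:R * (x l).1%:R.

Lemma queue_jump x w l : `|(next_queue x w l)%:R - (x l).1%:R| <= 1 :> R.
Proof.
rewrite /next_queue ler_norml; case: (x l) => [n [j|]] /=.
  rewrite (_ : (match n with 0 => _ | _ => _ end) = n + w.1 l)%N; last by case: n.
  by rewrite natrD; case: (w.1 l) => /=; lra.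
case: n => [|n]; first by case: (w.1 l) => /=; lra.
by rewrite natrD -natr1; case: (w.1 l) => /=; lra.
Qed.

Lemma tilted_jump eta i x w : 0 <= eta ->
  `|tilted eta i (step x w) - tilted eta i x
    - (workload q i (step x w) - workload q i x)| <= eta * (L%:R * L%:R).
Proof.
move=> eta0; rewrite /tilted.
rewrite (_ : _ - _ = eta * \sum_l (tilt i l)%:R * ((next_queue x w l)%:R - (x l).1%:R)).
  rewrite normrM ger0_norm // ler_wpM2l // (le_trans (ler_norm_sum _ _ _)) //.
  rewrite -[X in X%:R * _](card_ord L) mulr_natl -sumr_const; apply: ler_sum => l _.
  rewrite normrM ger0_norm // -[leRHS]mulr1 ler_pM // ?ler_nat ?tilt_le //.
  exact: queue_jump.
have -> : \sum_l (tilt i l)%:R * (step x w l).1%:R =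
    \sum_l (tilt i l)%:R * (next_queue x w l)%:R :> R.
  by apply: eq_bigr => l _; rewrite ffunE.
under [in RHS]eq_bigr do rewrite mulrBr.
by rewrite sumrB; ring.
Qed.

(** Queue [i] is empty, and for every other queue the claims do not decrease from [i] to [i - 1]
    while the tilt gains [eta] per vehicle. Riding vehicles cost at most [B] per cell. *)
Lemma tilted_idle eta i x : 0 <= eta -> (x i).1 = 0%N ->
  tilted eta i x <= tilted eta (ord_pred i) x - eta * queued x + L%:R * B.
Proof.
move=> eta0 xi.
rewrite -[X in X%:R * B](card_ord L) mulr_natl -sumr_const.
rewrite /tilted /workload /queued !mulr_sumr -!big_split -sumrB -big_split /=.
apply: ler_sum => l _.
have rB := riding_le hq hqprod i l (x l).2.
have r0 := riding_ge0 hq hqprod (ord_pred i) l (x l).2.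
have [->|li] := eqVneq l i.
  rewrite xi !mulr0; have := riding_le hq hqprod i i (x i).2.
  have := riding_ge0 hq hqprod (ord_pred i) i (x i).2; lra.
have cl : claim q i l * (x l).1%:R <= claim q (ord_pred i) l * (x l).1%:R.
  by rewrite ler_wpM2r // claim_ord_pred.
have tl : eta * ((tilt i l)%:R * (x l).1%:R) + eta * (x l).1%:R <=
    eta * ((tilt (ord_pred i) l)%:R * (x l).1%:R).
  rewrite (_ : _ + _ = eta * ((tilt i l).+1%:R * (x l).1%:R)); last first.
    by rewrite -natr1; ring.
  by rewrite ler_wpM2l // ler_wpM2r // ler_nat tilt_ord_pred.
lra.
Qed.

Lemma traffic_stable : (0 < L)%N -> (forall i, \sum_l claim q i l * p l < 1) ->
  roundabout_stable p q.
Proof.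
move=> L0 light x reach_x.
pose i0 := Ordinal L0.
have mu0 := decisions_prob_ge0 hp hq.
have mu1 := decisions_prob_sum p q.
have B0 : 0 <= B by exact: vis_bound_ge0.
have L1 : 1 <= L%:R :> R by rewrite ler1n.
have [d [d0 d1 dl]] : exists d : R, [/\ 0 < d, d <= 1 &
    forall i, \sum_l claim q i l * p l <= 1 - d].
  case: (@arg_minP _ _ _ i0 xpredT (fun i => 1 - \sum_l claim q i l * p l)) => // m _ mm.
  exists (1 - \sum_l claim q m l * p l); split.
  - by rewrite subr_gt0.
  - rewrite gerBl sumr_ge0 // => l _; rewrite mulr_ge0 ?claim_ge0 //.
    by case/andP: (hp l).
  - by move=> i; have := mm i isT; lra.
(* The tilt spends half of the slack [d], leaving a drift of at most [- d / 2]. *)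
pose eta := d / (2 * (L%:R * L%:R)).
have LL0 : 0 < L%:R * L%:R :> R by rewrite mulr_gt0 // ltr0n.
have eta0 : 0 < eta by rewrite divr_gt0 // mulr_gt0.
have etaL : eta * (L%:R * L%:R) = d / 2 by rewrite /eta; field; rewrite gt_eqF // ltr0n.
have LB : L%:R <= L%:R * (1 + 2 * B) by rewrite ler_peMr // ?lerDl ?mulr_ge0.
have jump i y w := tilted_jump i y w (ltW eta0).
have LB0 : 0 <= L%:R * B by rewrite mulr_ge0.
have eL : 0 <= eta * L%:R by rewrite mulr_ge0 // ltW.
(* A cell occupied in front of an empty queue is treated as idle, since [tilted_idle] asks only for
   an empty queue. *)
have [||||||||| f [K0 [K [f0 K0' fd]]]] := @exponential_lyapunov R state decisions
  'I_L step mu mu0 mu1 (tilted eta) queued (fun i y => (0 < (y i).1)%N)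
  (@ord_pred L) i0 (1 + B + L%:R * B + eta * L%:R) (L%:R * (1 + 2 * B) + d / 2)
  (L%:R * B) (d / 2) eta _ _ _ eta0.
- by rewrite divr_gt0.
- lra.
- lra.
- lra.
- move=> i y w; have := jump i y w; have := workload_jump hq hqprod i y w.
  by rewrite etaL !ler_norml => /andP[? ?] /andP[? ?]; apply/andP; split; lra.
- move=> i y yi.
  have u : used y i by apply: contraTneq yi => ->.
  have : mean (tilted eta i) y - tilted eta i y - (mean (workload q i) y - workload q i y)
      <= d / 2.
    rewrite -etaL.
    rewrite -[leRHS](mean_next_cst step mu1 _ y).
    rewrite (_ : _ - _ = \sum_w mu w * (tilted eta i (step y w) - tilted eta i y
       - (workload q i (step y w) - workload q i y))).
      apply: ler_sum => w _; rewrite ler_wpM2l //.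
      exact: le_trans (ler_norm _) (jump i y w).
    rewrite -[X in _ - X - _](mean_next_cst step mu1 _ y).
    rewrite -[X in _ - (_ - X)](mean_next_cst step mu1 _ y).
    by rewrite /mean_next -!sumrB; apply: eq_bigr => w _; rewrite !mulrBr.
  by rewrite mean_workload // u mulr1n; have := dl i; lra.
- move=> i y; rewrite -eqn0Ngt => /eqP; exact: tilted_idle (ltW eta0).
- move=> i y; apply: addr_ge0; first exact: workload_ge0.
  by apply: mulr_ge0; [exact: ltW|apply: sumr_ge0 => l _; rewrite mulr_ge0].
- move=> i y.
  have W : workload q i y <= (1 + B) * queued y + L%:R * B.
    rewrite /workload big_split /= lerD //.
      by rewrite mulr_sumr; apply: ler_sum => l _; rewrite ler_wpM2r // claim_le.
    rewrite -[X in X%:R * B](card_ord L) mulr_natl -sumr_const; apply: ler_sum => l _.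
    exact: riding_le.
  have T : eta * \sum_l (tilt i l)%:R * (y l).1%:R <= eta * L%:R * queued y.
    rewrite -mulrA ler_wpM2l ?(ltW eta0) // /queued mulr_sumr; apply: ler_sum => l _.
    by rewrite ler_wpM2r // ler_nat tilt_le.
  have Q0 := queued_ge0 y.
  have LBQ : 0 <= L%:R * B * queued y by rewrite !mulr_ge0.
  rewrite /tilted; lra.
(* A bound on [drain_time] over all states with [queued y <= K0]. *)
pose N := (Num.bound K0 * L.+1 + L * L)%N.
apply: (@foster_reachable R state decisions step mu mu0 mu1 x empty_state (drain q) N
  (fun y => queued y <= K0) f K) => //.
- exact: drain_prob_gt0.
- exact: drain_empty.
- move=> y yK; apply: (@drain_iter R L q hq hqprod).
  apply: leq_trans (drain_time_le hq hqprod y) _; rewrite leq_add2r leq_mul2r /=.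
  rewrite -(ler_nat R) natr_sum -/(queued y) (le_trans yK) // ltW //.
  by rewrite archi_boundP // (le_trans (queued_ge0 y)).
Qed.
End sufficiency.

Theorem theorem3p4 (R : realType) (L : nat) (hL : (0 < L)%N)
    (p : 'I_L -> R) (q : 'I_L -> 'I_L -> R)
    (hp : forall i : 'I_L, 0 <= p i < 1)
    (hq : forall i j : 'I_L, 0 <= q i j <= 1)
    (hqprod : forall j : 'I_L, \prod_(l < L) (1 - q l j) < 1) :
  roundabout_stable p q <-> (forall i : 'I_L, ((p i)%:E < pi0 p q i)%E).
Proof.
split=> [st i|h].
  by apply/(pi0E p hq hqprod); exact: stable_traffic st i.
by apply: traffic_stable => // i; apply/(pi0E p hq hqprod).
Qed.
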